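(* In the generic framework of the context, define for each ordinal $\delta$ the property $P_\delta$: for all $n\in\mathbb N$ and all $s,s'\in\mathcal D^\infty$, if $s\rightsquigarrow^\delta_n s'$ then there exist $s''\in\mathcal D^\infty$ and an ordinal $\epsilon<\delta$ with $s\to^*s''$ and $s''\,(\overline{\twoheadrightarrow}_\epsilon)^*\,s'$; and the property $Q$: for every ordinal $\delta$ and all $s,t,t'\in\mathcal D^\infty$, if $P_\delta$ holds and $s\twoheadrightarrow_\delta t\to t'$, then there exists $s'\in\mathcal D^\infty$ with $s\to^*s'\twoheadrightarrow_\delta t'$. Then $\to$ has the Compression property if and only if $Q$ holds.
   Context: Fix a set $\mathcal S$ of statements. A derivation rule $r$ consists of an arity $k\in\mathbb N$, a partial function $r:\mathcal S^k\rightharpoonup\mathcal S$ and a map $c_r:\{1,\dots,k\}\to\{0,1\}$ (premiss $i$ coinductive iff $c_r(i)=1$). Fix a family $\mathcal D$ of derivation rules; $\mathcal D^\infty$ is the set of possibly infinite derivation trees built with rules of $\mathcal D$ in which every infinite branch passes through infinitely many coinductive premisses; $r(s_1,\dots,s_k)$ is the tree with last rule $r$ and immediate subtrees $s_i$. Truncation: $s|_0$ is the one-node tree given by a fresh nullary rule with the conclusion of $s$; $r(s_1,\dots,s_k)|_{d+1}=r(s_1|_{d+1-c_r(1)},\dots,s_k|_{d+1-c_r(k)})$; metric $\mathrm{dist}(s,t)=\inf\{2^{-d}:s|_d=t|_d\}$. Given zero steps $\to_0\subseteq\mathcal D^\infty\times\mathcal D^\infty$, the relation $\to$ with depths: $s\to_0t$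 gives $s\to^0t$; $s_i\to^ds_i'$ gives $r(\dots,s_i,\dots)\to^{d+c_r(i)}r(\dots,s_i',\dots)$; $\to^*$ is the reflexive transitive closure. A sequence $(s_\delta)_{\delta\le\gamma}$ with steps $s_\delta\to^{d_\delta}s_{\delta+1}$ is strongly converging if for each limit $\lambda\le\gamma$, $s_\delta\to s_\lambda$ and $d_\delta\to\infty$ as $\delta\to\lambda$; $s\twoheadrightarrow^\infty t$ if such a sequence of some ordinal length goes from $s$ to $t$. For every ordinal $\gamma$ (by well-founded induction), relations $\twoheadrightarrow_\gamma$, $\overline{\twoheadrightarrow}_\gamma$ are defined by: (split) $s\twoheadrightarrow_\gamma t$ if there are $m\in\mathbb N$, $s'$ with $s\rightsquigarrow^\gamma_ms'$ and $s'\,\overline{\twoheadrightarrow}_\gamma\,t$, where $s\rightsquigarrow^\gamma_ms'$ means there are ordinals $\delta_1,\dots,\delta_m<\gamma$ and trees with $s\to^*s_1'\,\overline{\twoheadrightarrow}_{\delta_1}\,t_1\to^*\cdots\overline{\twoheadrightarrow}_{\delta_m}\,t_m\to^*s'$ (for $m=0$: $s\to^*s'$); (lift$_r$) $r(s_1,\dots,s_k)\,\overline{\twoheadrightarrow}_\gamma\,r(s_1',\dots,s_k')$ if $s_i\twoheadrightarrow_\gamma s_i'$ for all $i$, premiss $i$ coinductive iff $c_r(i)=1$; derivations may be non-wellfounded provided every infinite branch crosses infinitely many coinductive premisses. $(\overline{\twoheadrightarrow}_\epsilon)^*$ is the reflexive transitive closure of $\overline{\twoheadrightarrow}_\epsilon$.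 Compressed rewriting $\twoheadrightarrow^\omega$ is $\twoheadrightarrow_0$ (i.e. $s\twoheadrightarrow^\omega t$ iff $s\to^* s'\,\overline{\twoheadrightarrow}_0\,t$ for some $s'$). $\to$ has the Compression property if $\twoheadrightarrow^\infty=\twoheadrightarrow^\omega$ (equivalently, $\bigcup_{\gamma<\omega_1}\twoheadrightarrow_\gamma=\twoheadrightarrow^\omega$, since $\twoheadrightarrow^\infty=\bigcup_{\gamma<\omega_1}\twoheadrightarrow_\gamma$).
   Formalization: P_δ also allows s''=s' with no ε (this changes only P_0, literally false). Compression as ⋃_{γ<ω₁}↠_γ=↠^ω is treated with no hypothesis; as ↠^∞=↠^ω only when s↠^ω t implies that s and t have the same conclusion. Without these changes the claim fails. *)

(* Defs.v *)
From mathcomp Require Import all_boot.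
From Stdlib Require Import Reals Relations Wellfounded.
From Stdlib Require Import FunctionalExtensionality ProofIrrelevance.
From Coquelicot Require Import Rbar Lub.

Set Implicit Arguments.
Unset Strict Implicit.
Unset Printing Implicit Defensive.

Local Open Scope nat_scope.

(* * Derivation rules and derivation trees *)

(* The partial function St^arity -> St is given by its graph; premisses are
   numbered from 0. *)
Record rule (St : Type) := Rule {
  arity : nat;
  app : ('I_arity -> St) -> St -> Prop;
  app_functional : forall f c c', app f c -> app f c' -> c = c';
  coind : 'I_arity -> bool
}.
Arguments Rule {St} arity app app_functional coind.
Arguments arity {St} r.
Arguments app {St} r f c.
Arguments coind {St} r i.

Definition coind_at (St : Type) (r : rule St) (i : nat) : bool :=
  oapp (coind r) false (insub i).

(* Trees are labellings of positions (sequences of premiss numbers, read from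
   the root) by a statement and a rule name, so that Leibniz equality is equality
   of possibly infinite trees.  [lab_local] says that a node has exactly
   [arity] children, and that its rule yields its statement from theirs. *)
Record derivation (St D : Type) (rl : D -> rule St) := Derivation {
  lab :> seq nat -> option (St * D);
  lab_root : lab [::] <> None;
  lab_closed : forall p i, lab p = None -> lab (rcons p i) = None;
  lab_local : forall p c r, lab p = Some (c, r) ->
    exists f : 'I_(arity (rl r)) -> St,
      app (rl r) f c /\
      forall i : nat, omap fst (lab (rcons p i)) = omap f (insub i);
  lab_branch : forall b : nat -> nat, (forall n, lab (mkseq b n) <> None) ->
    forall n, exists m c r,
      [/\ n <= m, lab (mkseq b m) = Some (c, r) & coind_at (rl r) (b m)]
}.

Section Trees.
Variables (St D : Type) (rl : D -> rule St).

Local Notation tree := (derivation rl).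

Definition conclusion (s : tree) : option St := omap fst (s [::]).

(* s = r(ss_1, ..., ss_k) *)
Definition is_node (r : D) (ss : 'I_(arity (rl r)) -> tree) (s : tree) : Prop :=
  (exists c, s [::] = Some (c, r)) /\
  forall (i : 'I_(arity (rl r))) p, s (val i :: p) = ss i p.

Lemma tree_ext (s t : tree) : (forall p, s p = t p) -> s = t.
Proof.
case: s t => [l1 a1 b1 c1 d1] [l2 a2 b2 c2 d2] /= e.
have {}e : l1 = l2 by apply: functional_extensionality.
subst l2.
by rewrite (proof_irrelevance _ a1 a2) (proof_irrelevance _ b1 b2)
           (proof_irrelevance _ c1 c2) (proof_irrelevance _ d1 d2).
Qed.

Lemma lab_undef (s : tree) p q : s p = None -> s (p ++ q) = None.
Proof.
move=> h; elim/last_ind: q => [|q i IH]; first by rewrite cats0.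
by rewrite -rcons_cat; apply: lab_closed.
Qed.

Lemma is_node_inj r ss s t : is_node (r := r) ss s -> is_node ss t -> s = t.
Proof.
move=> [[c hs] es] [[c' ht] et].
have [f [fc ef]] := lab_local hs.
have [f' [fc' ef']] := lab_local ht.
have eff : f = f'.
  apply: functional_extensionality => i.
  have := ef i; have := ef' i.
  rewrite /= (es i [::]) (et i [::]) valK /= => -> [].
  by [].
have ecc : c = c' by apply: app_functional fc _; rewrite eff.
apply: tree_ext => -[|i p]; first by rewrite hs ht ecc.
case: (ltnP i (arity (rl r))) => hi.
  by rewrite -[i]/(val (Ordinal hi)) es et.
have noneI (u : tree) (g : 'I_(arity (rl r)) -> St) :
    omap fst (u (rcons [::] i)) = omap g (insub i) -> u (i :: p) = None.
  move=> e; rewrite -cat1s; apply: lab_undef; move: e.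
  rewrite insubF; last by apply/negbTE; rewrite -leqNgt.
  by rewrite /=; case: (u [:: i]).
by rewrite (noneI _ _ (ef i)) (noneI _ _ (ef' i)).
Qed.

(* The rule name [None] is the fresh nullary rule. *)
Fixpoint trunc (d : nat) (l : seq nat -> option (St * D)) (p : seq nat) :
    option (St * option D) :=
  match l [::] with
  | None => None
  | Some (c, r) =>
    match p, d with
    | [::], 0 => Some (c, None)
    | [::], _.+1 => Some (c, Some r)
    | _ :: _, 0 => None
    | i :: p', _.+1 =>
        trunc (d - coind_at (rl r) i) (fun q => l (i :: q)) p'
    end
  end.

(* The infimum is taken in the extended reals: it is +oo when s and t have
   different conclusions. *)
Definition dist (s t : tree) : Rbar :=
  Glb_Rbar (fun x : R => exists d : nat,
    trunc d s = trunc d t /\ x = ((/ 2) ^ d)%R).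

Variable zero : tree -> tree -> Prop.

Inductive step : nat -> tree -> tree -> Prop :=
| step_zero s t : zero s t -> step 0 s t
| step_ctx (r : D) (ss ss' : 'I_(arity (rl r)) -> tree) (i : 'I_(arity (rl r)))
    d s s' :
    is_node ss s -> is_node ss' s' ->
    step d (ss i) (ss' i) -> (forall j, j <> i -> ss' j = ss j) ->
    step (d + coind (rl r) i) s s'.

Definition red (s t : tree) : Prop := exists d, step d s t.

Definition reds : tree -> tree -> Prop := clos_refl_trans tree red.

End Trees.

Arguments is_node {St D rl} r ss s.
Arguments conclusion {St D rl} s.

(* * Ordinals *)

(* An ordinal is represented by an element of a well-order, namely as the order
   type of the elements strictly below it. *)
Record wellorder := WellOrder {
  wcar :> Type;
  wlt : wcar -> wcar -> Prop;
  wlt_trans : forall x y z, wlt x y -> wlt y z -> wlt x z;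
  wlt_total : forall x y, wlt x y \/ x = y \/ wlt y x;
  wlt_wf : well_founded wlt
}.
Arguments wlt {w} x y.
Arguments wlt_wf w : clear implicits.

Definition wle (W : wellorder) (x y : W) : Prop := x = y \/ wlt x y.

Definition is_zero (W : wellorder) (x : W) : Prop := forall y, ~ wlt y x.

Definition is_succ (W : wellorder) (x y : W) : Prop :=
  wlt x y /\ forall z, wlt x z -> ~ wlt z y.

Definition is_limit (W : wellorder) (x : W) : Prop :=
  ~ is_zero x /\ forall y, ~ is_succ y x.

Definition countable_ordinal (W : wellorder) (x : W) : Prop :=
  exists f : W -> nat,
    forall y z, wlt y x -> wlt z x -> f y = f z -> y = z.

Lemma unit_lt_wf : well_founded (fun _ _ : unit => False).
Proof. by move=> x; constructor. Qed.

Definition unit_wellorder : wellorder.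
Proof.
refine (@WellOrder unit (fun _ _ => False) _ _ unit_lt_wf) => //.
by move=> [] []; right; left.
Defined.

(* * Strongly converging sequences *)

Section StronglyConverging.
Variables (St D : Type) (rl : D -> rule St).
Local Notation tree := (derivation rl).
Variable zero : tree -> tree -> Prop.

Definition strongly_converging (W : wellorder) (gamma : W)
    (s : W -> tree) (d : W -> nat) : Prop :=
  (forall x y, is_succ x y -> wle y gamma -> step zero (d x) (s x) (s y)) /\
  (forall l, is_limit l -> wle l gamma ->
    (forall e : R, (0 < e)%R ->
       exists2 b, wlt b l &
         forall x, wlt b x -> wlt x l -> Rbar_lt (dist (s x) (s l)) (Finite e)) /\
    (forall n : nat,
       exists2 b, wlt b l & forall x, wlt b x -> wlt x l -> n <= d x)).

Definition red_infty (s t : tree) : Prop :=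
  exists (W : wellorder) (o gamma : W) (u : W -> tree) (d : W -> nat),
    [/\ is_zero o, u o = s, u gamma = t & strongly_converging gamma u d].

End StronglyConverging.

(* * Coinductive rewriting *)

Section Coinductive.
Variables (St D : Type) (rl : D -> rule St).
Local Notation tree := (derivation rl).
Variable zero : tree -> tree -> Prop.

(* The judgments [s ->> t] and [s \overline{->>} t] at a fixed ordinal.  The
   system (split), (lift_r) deriving them is itself a family of derivation
   rules with coinductive premisses, so its possibly infinite derivations are
   those of [derivation]. *)
Inductive judgment :=
| Full of tree & tree
| Lifted of tree & tree.

Section Levels.
Variable below : tree -> tree -> Prop.

(* One instance of (split) for each pair [below s s']; one of (lift_r) for each
   rule r. *)
Inductive level_rule_name :=
| RSplit s s' of below s s'
| RLift of D.

Definition split_app (s s' : tree) (f : 'I_1 -> judgment) (j : judgment) : Prop :=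
  exists t, f ord0 = Lifted s' t /\ j = Full s t.

Definition lift_app (r : D) (f : 'I_(arity (rl r)) -> judgment)
    (j : judgment) : Prop :=
  exists ss ss' s s',
    [/\ is_node r ss s, is_node r ss' s',
        forall i, f i = Full (ss i) (ss' i) & j = Lifted s s'].

Lemma split_app_functional s s' f j j' :
  split_app s s' f j -> split_app s s' f j' -> j = j'.
Proof. by move=> [t [e ->]] [t' [e' ->]]; move: e'; rewrite e => -[->]. Qed.

Lemma lift_app_functional r f j j' :
  lift_app (r := r) f j -> lift_app f j' -> j = j'.
Proof.
move=> [ss1 [ss1' [s1 [s1' [h1 h1' e1 ->]]]]].
move=> [ss2 [ss2' [s2 [s2' [h2 h2' e2 ->]]]]].
have e i : ss1 i = ss2 i /\ ss1' i = ss2' i.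
  by have := e1 i; rewrite e2 => -[-> ->].
have ess : ss1 = ss2 by apply: functional_extensionality => i; case: (e i).
have ess' : ss1' = ss2' by apply: functional_extensionality => i; case: (e i).
subst ss2 ss2'.
by rewrite (is_node_inj h1 h2) (is_node_inj h1' h2').
Qed.

Definition level_rule (a : level_rule_name) : rule judgment :=
  match a with
  | RSplit s s' _ =>
      Rule 1 (split_app s s') (@split_app_functional s s') (fun _ => false)
  | RLift r =>
      Rule (arity (rl r)) (@lift_app r) (@lift_app_functional r) (coind (rl r))
  end.

Definition derivable (j : judgment) : Prop :=
  exists T : derivation level_rule, conclusion T = Some j.

End Levels.

Fixpoint chain (B : tree -> tree -> Prop) (m : nat) (s s' : tree) : Prop :=
  match m with
  | 0 => reds zero s s'
  | m'.+1 => exists u t, [/\ chain B m' s u, B u t & reds zero t s']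
  end.

Section Rew.
Variable W : wellorder.

Definition rew_lifted_F (gamma : W)
    (rec : forall delta : W, wlt delta gamma -> tree -> tree -> Prop)
    (s t : tree) : Prop :=
  derivable
    (fun u u' => exists m,
       chain (fun v w => exists (delta : W) (h : wlt delta gamma), rec delta h v w)
         m u u')
    (Lifted s t).

Definition rew_lifted : W -> tree -> tree -> Prop :=
  Fix (wlt_wf W) (fun _ => tree -> tree -> Prop) rew_lifted_F.

Definition squig (gamma : W) : nat -> tree -> tree -> Prop :=
  chain (fun v w => exists (delta : W) (_ : wlt delta gamma), rew_lifted delta v w).

Definition rew (gamma : W) (s t : tree) : Prop :=
  derivable (fun u u' => exists m, squig gamma m u u') (Full s t).

Lemma rew_liftedE (gamma : W) (s t : tree) :
  rew_lifted gamma s t =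
  derivable (fun u u' => exists m, squig gamma m u u') (Lifted s t).
Proof.
rewrite /rew_lifted Fix_eq // => x f g e.
have -> // : f = g.
by do 2![apply: functional_extensionality_dep => ?]; apply: e.
Qed.

End Rew.

Definition compressed : tree -> tree -> Prop := rew (tt : unit_wellorder).

(* * The Compression property and its criterion *)

Definition compression : Prop :=
  forall s t : tree, red_infty zero s t <-> compressed s t.

Definition ordinal_compression : Prop :=
  forall s t : tree,
    (exists (W : wellorder) (gamma : W), countable_ordinal gamma /\ rew gamma s t)
    <-> compressed s t.

(* [lift_app] does not compare conclusions, and an infinite branch need not
   determine them: with one unary coinductive rule, the identity on statements,
   and no zero step, [compressed] relates the infinite trees labelled A and B
   throughout, which no strongly converging sequence does. *)
Definition preserves_conclusions : Prop :=
  forall s t : tree, compressed s t -> conclusion s = conclusion t.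

(* The disjunct [s'' = s'] matters only for delta = 0, where there is no
   epsilon < delta: the empty chain of lifted rewritings still counts.  For
   delta > 0 it is absorbed by the reflexive closure. *)
Definition P (W : wellorder) (delta : W) : Prop :=
  forall (n : nat) (s s' : tree), squig delta n s s' ->
    exists s'' : tree, reds zero s s'' /\
      (s'' = s' \/
       exists2 epsilon : W, wlt epsilon delta &
         clos_refl_trans tree (rew_lifted epsilon) s'' s').

Definition Q : Prop :=
  forall (W : wellorder) (delta : W) (s t t' : tree),
    P delta -> rew delta s t -> red zero t t' ->
    exists s' : tree, reds zero s s' /\ rew delta s' t'.

End Coinductive.

(* Main.v *)
(** Only the instance of [Q] at ordinal 0 matters: there [P] is trivial, and the
    instance says that a step following a compressed rewriting is absorbed by
    it ([step_absorption]).  Absorption turns a finite chain of lifted level-0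
    rewritings and finite reductions into a finite reduction followed by lifted
    rewritings only; the latter can be pushed below the roots, so by coinduction
    the levels collapse to 0 one after the other.

    In a strongly converging sequence of limit length, all steps beyond some
    point have depth at least 1, hence take place below coinductive premisses.
    The initial segment is compressed by transfinite induction, and the rest
    splits into sequences for the subtrees at these premisses, to which
    coinduction applies.  Conversely, a compressed rewriting is unfolded to depth
    n for every n, which gives a sequence of length at most omega; here rules
    must stay applicable after rewriting a premiss, whence
    [preserves_conclusions]. *)

From mathcomp Require Import all_boot.
From Stdlib Require Import Reals Lra Relations ClassicalEpsilon.
From Stdlib Require Import FunctionalExtensionality.
From Coquelicot Require Import Rbar Lub.
Require Import Defs.

Set Implicit Arguments.
Unset Strict Implicit.
Unset Printing Implicit Defensive.

Local Open Scope nat_scope.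

(** * Trees as nodes with subtrees; induction and coinduction on derivations *)

Section Derivations.
Variables (St D : Type) (rl : D -> rule St).
Implicit Types T U : derivation rl.

Lemma subtree_ex T p : T p <> None -> exists U, forall q, U q = T (p ++ q).
Proof.
move=> hp.
have h1 : T (p ++ [::]) <> None by rewrite cats0.
have h2 q i : T (p ++ q) = None -> T (p ++ rcons q i) = None.
  by rewrite -rcons_cat; apply: lab_closed.
have h3 q c r : T (p ++ q) = Some (c, r) ->
    exists f : 'I_(arity (rl r)) -> St, app (rl r) f c /\
      forall i : nat, omap fst (T (p ++ rcons q i)) = omap f (insub i).
  move=> hq; have [f [fc e]] := lab_local hq.
  by exists f; split=> // i; rewrite -rcons_cat.
have h4 (b : nat -> nat) : (forall n, T (p ++ mkseq b n) <> None) ->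
    forall n, exists m c r, [/\ n <= m, T (p ++ mkseq b m) = Some (c, r) &
      coind_at (rl r) (b m)].
  move=> hb n.
  (* Prefixing a branch of the subtree by [p] gives a branch of [T], whose coinductive premisses
     beyond [p] belong to the subtree. *)
  pose b' k := if k < size p then nth 0 p k else b (k - size p).
  have b'E m : mkseq b' (size p + m) = p ++ mkseq b m.
    rewrite /mkseq iotaD map_cat; congr (_ ++ _).
      rewrite -[RHS](mkseq_nth 0); apply/eq_in_map => k.
      by rewrite mem_iota /b' => /andP [_ ->].
    rewrite add0n -[X in iota X m]addn0 iotaDl -map_comp.
    by apply: eq_map => k /=; rewrite /b' ltnNge leq_addr addKn.
  have hb' m : T (mkseq b' m) <> None.
    case: (leqP (size p) m) => hm; first by rewrite -(subnKC hm) b'E.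
    move=> e; apply: hp.
    have -> : p = mkseq b' m ++ drop m p; last exact: lab_undef.
    rewrite -{1}(cat_take_drop m p); congr (_ ++ _).
    have <- : take m (mkseq b' (size p)) = mkseq b' m.
      by rewrite /mkseq -map_take take_iota (minn_idPl (ltnW hm)).
    by have := b'E 0; rewrite addn0 /= cats0 => ->.
  have [m [c [r [hm e hc]]]] := lab_branch hb' (size p + n).
  have hm' : size p <= m by rewrite (leq_trans _ hm) // leq_addr.
  move: e hc; rewrite /b' ltnNge hm' /= -{1}(subnKC hm') b'E => e hc.
  by exists (m - size p), c, r; split=> //; rewrite leq_subRL.
by exists (@Derivation _ _ rl (fun q => T (p ++ q)) h1 h2 h3 h4).
Qed.

Lemma node_ex T : exists r ss, is_node r ss T.
Proof.
case e: (T [::]) (lab_root (d := T)) => [[c r]|] // _.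
have [f [fc ef]] := lab_local e.
have /choice [ss hss] : forall i : 'I_(arity (rl r)),
    exists U, forall q, U q = T (val i :: q).
  move=> i; apply: (@subtree_ex T [:: val i]).
  by move: (ef (val i)); rewrite /= valK /=; case: (T _).
exists r, ss; split; first by exists c.
by move=> i p; rewrite hss.
Qed.

Lemma is_node_rule r r' ss ss' T :
  is_node (rl := rl) r ss T -> is_node r' ss' T -> r = r'.
Proof. by move=> [[c e] _] [[c' e'] _]; move: e'; rewrite e => -[]. Qed.

Lemma is_node_children r ss ss' T :
  is_node (rl := rl) r ss T -> is_node r ss' T -> ss = ss'.
Proof.
move=> [_ e] [_ e']; apply: functional_extensionality => i.
by apply: tree_ext => p; rewrite -e e'.
Qed.

Lemma is_node_app r ss T : is_node (rl := rl) r ss T ->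
  exists f c, [/\ app (rl r) f c, conclusion T = Some c
    & forall i, conclusion (ss i) = Some (f i)].
Proof.
move=> [[c e] es]; have [f [fc ef]] := lab_local e.
exists f, c; split=> //; first by rewrite /conclusion e.
by move=> i; rewrite /conclusion -es; have := ef i; rewrite valK.
Qed.

Lemma is_node_conclusion r ss ss' T U :
  is_node (rl := rl) r ss T -> is_node r ss' U ->
  (forall i, conclusion (ss' i) = conclusion (ss i)) ->
  conclusion U = conclusion T.
Proof.
move=> /is_node_app [f [c [fc -> ef]]] /is_node_app [f' [c' [fc' -> ef']]] e.
have ff : f = f'.
  apply: functional_extensionality => i.
  by have := e i; rewrite ef ef' => -[].
by rewrite -ff in fc'; rewrite (app_functional fc fc').
Qed.

(** A rule reads only the conclusions of its premisses, so it still applies when each premiss keeps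
    its conclusion. *)
Lemma node_replace r ss ss' T : is_node (rl := rl) r ss T ->
  (forall i, conclusion (ss' i) = conclusion (ss i)) ->
  exists U, is_node r ss' U.
Proof.
move=> hT ec; have [f [c [fc eT ef]]] := is_node_app hT.
pose l p := if p is i :: q then obind (fun j => ss' j q) (insub i)
  else Some (c, r).
have h1 : l [::] <> None by [].
have h2 p i : l p = None -> l (rcons p i) = None.
  by case: p => [|j p] //=; case: (insub j) => //= k; apply: lab_closed.
have h3 p d r' : l p = Some (d, r') ->
    exists f : 'I_(arity (rl r')) -> St, app (rl r') f d /\
      forall i : nat, omap fst (l (rcons p i)) = omap f (insub i).
  case: p => [[<- <-]|j p] /=; last first.
    case: (insub j) => //= k hk.
    exact: lab_local hk.
  exists f; split=> // i; case: (insub i) => //= j.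
  by rewrite -ef -ec.
have h4 b : (forall n, l (mkseq b n) <> None) -> forall n,
    exists m d r', [/\ n <= m, l (mkseq b m) = Some (d, r') &
      coind_at (rl r') (b m)].
  have mkE m : mkseq b m.+1 = b 0 :: mkseq (b \o succn) m.
    by rewrite /mkseq /= -[1]/(1 + 0) iotaDl -map_comp.
  move=> hb n; have := hb 1; rewrite mkE /=.
  case e: (insub (b 0)) => [j|] // _.
  have hb' m : ss' j (mkseq (b \o succn) m) <> None.
    by have := hb m.+1; rewrite mkE /= e.
  have [m [d [r' [hm em hr]]]] := lab_branch hb' n.
  by exists m.+1, d, r'; rewrite mkE /= e; split=> //; apply: ltnW.
exists (@Derivation _ _ rl l h1 h2 h3 h4); split; first by exists c.
by move=> i p /=; rewrite valK.
Qed.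

Inductive ind_wf T : Prop :=
  IndWf r ss of is_node r ss T &
    (forall i, ~~ coind (rl r) i -> ind_wf (ss i)).

(** Otherwise bad non-coinductive premisses can be chosen for ever, which gives an infinite branch
    without coinductive premisses. *)
Lemma derivation_wf T : ind_wf T.
Proof.
apply: NNPP => nT.
pose bad p := exists2 U : derivation rl, (forall q, U q = T (p ++ q)) & ~ ind_wf U.
have next p : exists i, bad p -> bad (rcons p i) /\
    forall c r, T p = Some (c, r) -> ~~ coind_at (rl r) i.
  case: (classic (bad p)) => [[U eU nU]|]; last by exists 0.
  have [r [ss hU]] := node_ex U.
  have [i [hi ni]] : exists i, ~~ coind (rl r) i /\ ~ ind_wf (ss i).
    apply: NNPP => h; apply: nU; apply: (IndWf hU) => i hi.
    by apply: NNPP => ni; apply: h; exists i.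
  exists (val i) => _; split.
    by exists (ss i) => // q; rewrite cat_rcons -eU; case: hU => _ ->.
  move=> c r'; rewrite -[p]cats0 -eU; case: hU => [[c' ->] _] [_ <-].
  by rewrite /coind_at valK.
have [b hb] := choice _ next.
pose pos := fix pos n := if n is n'.+1 then rcons (pos n') (b (pos n')) else [::].
have posE n : mkseq (fun k => b (pos k)) n = pos n.
  by elim: n => // n IH; rewrite mkseqS IH.
have bad_pos n : bad (pos n).
  by elim: n => [|n IH]; [exists T | case: (hb _ IH)].
have hT n : T (mkseq (fun k => b (pos k)) n) <> None.
  have [U eU _] := bad_pos n; rewrite posE -[pos n]cats0 -eU.
  exact: lab_root.
have [m [c [r [_ e hc]]]] := lab_branch hT 0.
have [_ /(_ c r)] := hb _ (bad_pos m).
by move: e; rewrite posE => -> /(_ erefl); rewrite hc.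
Qed.

Definition provable (c : St) : Prop := exists T, conclusion T = Some c.

(** An operator whose greatest fixed point is provability: rules are applied inductively down to the
    first coinductive premisses, where [X] takes over. *)
Inductive layer (X : St -> Prop) (c : St) : Prop :=
  Layer r f of app (rl r) f c & (forall i, coind (rl r) i -> X (f i)) &
    (forall i, ~~ coind (rl r) i -> layer X (f i)).

Lemma provable_layer c : provable c -> layer provable c.
Proof.
case=> T; elim: {T}(derivation_wf T) c => T r ss hT _ IH c e.
have [f [c' [fc e' ef]]] := is_node_app hT.
move: e'; rewrite e => -[cc']; subst c'.
apply: (Layer fc) => i hi; first by exists (ss i).
exact: IH hi _ (ef i).
Qed.

Lemma layer_mono (X Y : St -> Prop) c :
  (forall c, X c -> Y c) -> layer X c -> layer Y c.
Proof.
move=> XY; elim=> {}c r f fc hX _ IH; apply: (Layer fc) => i hi.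
  exact/XY/hX.
exact: IH.
Qed.

Section Coinduction.
Variable X : St -> Prop.
Hypothesis X_layer : forall c, X c -> layer X c.

(** The same data in [Type], since the labelling of a tree must be computed from it. *)
Inductive layerT (c : St) : Type :=
  LayerT r f of app (rl r) f c & (forall i, coind (rl r) i -> X (f i)) &
    (forall i, ~~ coind (rl r) i -> layerT (f i)).

Lemma layerT_inhabited c : layer X c -> inhabited (layerT c).
Proof.
elim=> {}c r f fc hX _ IH; apply: inhabits; apply: (LayerT fc hX) => i hi.
by have [] := constructive_indefinite_description (fun=> True)
  (let: inhabits x := IH i hi in ex_intro _ x I).
Qed.

Definition restart c (h : X c) : layerT c :=
  sval (constructive_indefinite_description (fun=> True)
    (let: inhabits x := layerT_inhabited (X_layer h) in ex_intro _ x I)).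

Definition continue_layer (b : bool) c :
    (b -> X c) -> (~~ b -> layerT c) -> layerT c :=
  match b as b' return (b' -> X c) -> (~~ b' -> layerT c) -> layerT c with
  | true => fun hX _ => restart (hX isT)
  | false => fun _ hL => hL isT
  end.

Lemma continue_layerN (b : bool) c (hX : b -> X c) (hL : ~~ b -> layerT c) (h : ~~ b) :
  continue_layer hX hL = hL h.
Proof. by case: b hX hL h => //= hX hL h; congr hL; apply: bool_irrelevance. Qed.

(** The tree is generated by an automaton: a state is a statement with what is left of its layer. A
    coinductive premiss opens a fresh layer, any other one descends in the current layer. *)
Definition state := {c : St & layerT c}.

Definition state_rule (x : state) : D :=
  let: existT c (LayerT r _ _ _ _) := x in r.

Definition child (x : state) (i : nat) : option state :=
  let: existT c (LayerT r f _ hX hL) := x in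
  omap (fun j => existT layerT (f j) (continue_layer (hX j) (hL j))) (insub i).

Definition walk (x : state) (p : seq nat) : option state :=
  foldl (fun o i => obind (child^~ i) o) (Some x) p.

Definition walk_lab (x : state) (p : seq nat) : option (St * D) :=
  omap (fun y => (tag y, state_rule y)) (walk x p).

Lemma walk_rcons x p i : walk x (rcons p i) = obind (child^~ i) (walk x p).
Proof. by rewrite /walk foldl_rcons. Qed.

(** Induction on the layer at the current position: a non-coinductive premiss leads to a proper part
    of it, so a coinductive one must come. *)
Lemma walk_branch x b : (forall n, walk x (mkseq b n) <> None) ->
  forall n c (l : layerT c), walk x (mkseq b n) = Some (existT _ c l) ->
  exists m c r,
    [/\ n <= m, walk_lab x (mkseq b m) = Some (c, r) & coind_at (rl r) (b m)].
Proof.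
move=> hb n c l; elim: l n => {}c r f fc hX hL IH n e.
have := hb n.+1; rewrite mkseqS walk_rcons e /=.
case hi: (insub (b n)) => [i|] //= _.
case: (boolP (coind (rl r) i)) => hc.
  by exists n, c, r; rewrite /walk_lab e /coind_at hi.
have e' : walk x (mkseq b n.+1) = Some (existT _ (f i) (hL i hc)).
  by rewrite mkseqS walk_rcons e /= hi /= (continue_layerN _ _ hc).
have [m [c' [r' [hm em hr]]]] := IH _ _ _ e'.
by exists m, c', r'; split=> //; apply: ltnW.
Qed.

Lemma provable_coind c : X c -> provable c.
Proof.
move=> /restart l; pose x : state := existT _ c l.
have h1 : walk_lab x [::] <> None by [].
have h2 p i : walk_lab x p = None -> walk_lab x (rcons p i) = None.
  by rewrite /walk_lab walk_rcons; case: (walk x p).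
have h3 p d r : walk_lab x p = Some (d, r) ->
    exists f : 'I_(arity (rl r)) -> St, app (rl r) f d /\
      forall i : nat, omap fst (walk_lab x (rcons p i)) = omap f (insub i).
  rewrite /walk_lab; case e: (walk x p) => [[d' [r' f fc hX hL]]|] //= [<- <-].
  exists f; split=> // i; rewrite walk_rcons e /=.
  by case: (insub i).
have h4 b : (forall n, walk_lab x (mkseq b n) <> None) -> forall n,
    exists m d r, [/\ n <= m, walk_lab x (mkseq b m) = Some (d, r) &
      coind_at (rl r) (b m)].
  move=> hb n.
  have hw k : walk x (mkseq b k) <> None.
    by move=> e; apply: (hb k); rewrite /walk_lab e.
  case e: (walk x (mkseq b n)) (hw n) => [[d l']|] // _.
  exact: (walk_branch hw e).
by exists (@Derivation _ _ rl (walk_lab x) h1 h2 h3 h4).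
Qed.

End Coinduction.

(** By monotonicity and [provable_layer], [layer provable] is contained in its own layer, so
    coinduction applies to it. *)
Lemma layer_provable c : layer provable c -> provable c.
Proof.
apply: provable_coind => {}c; apply: layer_mono; exact: provable_layer.
Qed.

End Derivations.

(** * Derivations of the rewriting judgments *)

Section Judgments.
Variables (St D : Type) (rl : D -> rule St).
Local Notation tree := (derivation rl).
Local Notation lrule below := (@level_rule St D rl below).
Implicit Types (s t : tree) (below : tree -> tree -> Prop).

(** One layer of a derivation of a full judgment, each split being merged with the lift that follows
    it. *)
Inductive full_layer below (X : tree -> tree -> Prop) s t : Prop :=
  FullLayer s' r ss ts of below s s' & is_node r ss s' & is_node r ts t &
    (forall i, coind (rl r) i -> X (ss i) (ts i)) &
    (forall i, ~~ coind (rl r) i -> full_layer below X (ss i) (ts i)).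

Lemma full_layer_mono below below' (X Y : tree -> tree -> Prop) s t :
  (forall s t, below s t -> below' s t) -> (forall s t, X s t -> Y s t) ->
  full_layer below X s t -> full_layer below' Y s t.
Proof.
move=> hb hX; elim=> {}s {}t s' r ss ts /hb b hs ht hc _ IH.
by apply: (FullLayer b hs ht) => // i hi; apply/hX/hc.
Qed.

Lemma full_coind below (X : tree -> tree -> Prop) :
  (forall s t, X s t -> full_layer below X s t) ->
  forall s t, X s t -> derivable below (Full s t).
Proof.
move=> hX s t h.
(* Lifted judgments stay out of the invariant: they arise only as the non-coinductive premiss of a
   split, within a layer. *)
pose X' (j : judgment rl) := if j is Full u v then X u v else False.
apply: (@provable_coind _ _ (lrule below) X' _ (Full s t) h) => -[u v|u v] //= /hX.
elim=> {}u {}v u' r us vs b hu hv hc _ IH.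
apply: (@Layer _ _ (lrule below) X' (Full u v) (RSplit b) (fun=> Lifted u' v)) => //=.
  by exists v.
move=> _ _.
apply: (@Layer _ _ (lrule below) X' _ (RLift _ r)
  (fun i => Full (us i) (vs i))) => //=.
by exists us, vs, u', v.
Qed.

Lemma derivable_splitP below s t : derivable below (Full s t) <->
  exists2 s', below s s' & derivable below (Lifted s' t).
Proof.
split=> [h|[s' b hl]].
  have := provable_layer h.
  case=> -[u v b|r] f /=; last by move=> [? [? [? [? []]]]].
  move=> [w [fw [-> ->]]] _ /(_ ord0 isT) h'; exists v => //.
  by apply: (@layer_provable _ _ (lrule below)); rewrite -fw.
apply: (@layer_provable _ _ (lrule below)).
apply: (@Layer _ _ (lrule below) _ (Full s t) (RSplit b) (fun=> Lifted s' t)) => //=.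
  by exists t.
by move=> _ _; apply: provable_layer.
Qed.

Lemma derivable_liftP below s t : derivable below (Lifted s t) <->
  exists r ss ts, [/\ is_node r ss s, is_node r ts t &
    forall i, derivable below (Full (ss i) (ts i))].
Proof.
split=> [h|[r [ss [ts [hs ht h]]]]].
  have := provable_layer h.
  case=> -[u v b|r] f /=; first by move=> [? []].
  move=> [ss [ts [s' [t' [hs ht ef [-> ->]]]]]] hc hi.
  exists r, ss, ts; split=> // i; rewrite -ef.
  case: (boolP (coind (rl r) i)) => [/hc //|/hi];
    exact: (@layer_provable _ _ (lrule below)).
apply: (@layer_provable _ _ (lrule below)).
apply: (@Layer _ _ (lrule below) _ (Lifted s t) (RLift _ r)
  (fun i => Full (ss i) (ts i))) => //= [|i _|i _].
- by exists ss, ts, s, t.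
- exact: h.
- exact/provable_layer/h.
Qed.

Lemma derivable_full_layer below s t : derivable below (Full s t) ->
  full_layer below (fun u v => derivable below (Full u v)) s t.
Proof.
set X := fun u v => _; move=> h.
(* Induction on the layer meets both kinds of judgments, so the claim needs a clause for lifted
   ones. *)
suff: forall j, layer (lrule below) (provable (lrule below)) j ->
    match j with
    | Full u v => full_layer below X u v
    | Lifted u v => exists r us vs, [/\ is_node r us u, is_node r vs v,
        forall i, coind (rl r) i -> X (us i) (vs i) &
        forall i, ~~ coind (rl r) i -> full_layer below X (us i) (vs i)]
    end.
  by move=> /(_ (Full s t)); apply; apply: provable_layer.
move=> {s t h} j; elim=> {}j [u v b|r] f /=.
  move=> [w [fw ->]] _ _ /(_ ord0 isT); rewrite fw => -[r [us [vs [hu hv hc hi]]]].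
  exact: (FullLayer b hu hv).
move=> [us [vs [u [v [hu hv ef ->]]]]] hc _ hi; exists r, us, vs.
split=> // i hci; first by move: (hc i hci); rewrite ef.
by move: (hi i hci); rewrite ef.
Qed.

Lemma full_mono below below' s t : (forall s t, below s t -> below' s t) ->
  derivable below (Full s t) -> derivable below' (Full s t).
Proof.
move=> hb; move: s t; apply: full_coind => s t /derivable_full_layer.
exact: full_layer_mono.
Qed.

Lemma lifted_mono below below' s t : (forall s t, below s t -> below' s t) ->
  derivable below (Lifted s t) -> derivable below' (Lifted s t).
Proof.
move=> hb /derivable_liftP [r [ss [ts [hs ht h]]]]; apply/derivable_liftP.
by exists r, ss, ts; split=> // i; apply: full_mono (h i).
Qed.

Lemma full_refl below s : (forall s, below s s) -> derivable below (Full s s).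
Proof.
move=> hb; apply: (@full_coind below eq) => // {}s t <-.
elim: (derivation_wf s) => {}s r ss hs _ IH.
exact: (FullLayer (hb s) hs hs).
Qed.

Lemma lifted_refl below s : (forall s, below s s) ->
  derivable below (Lifted s s).
Proof.
move=> hb; apply/derivable_liftP; have [r [ss hs]] := node_ex s.
by exists r, ss, ss; split=> // i; apply: full_refl.
Qed.

(** * Rewriting at ordinal 0, and step absorption *)

Variable zero : tree -> tree -> Prop.

Lemma reds_refl s : reds zero s s.
Proof. exact: rt_refl. Qed.

Lemma reds_trans s t u : reds zero s t -> reds zero t u -> reds zero s u.
Proof. exact: rt_trans. Qed.

Lemma chain_mono (B B' : tree -> tree -> Prop) m s t :
  (forall s t, B s t -> B' s t) -> chain zero B m s t -> chain zero B' m s t.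
Proof.
move=> hB; elim: m t => //= m IH t [u [v [/IH h1 /hB h2 h3]]].
by exists u, v.
Qed.

Lemma chain_cons (B : tree -> tree -> Prop) m s s' t u :
  reds zero s s' -> B s' t -> chain zero B m t u -> chain zero B m.+1 s u.
Proof.
move=> h1 h2; elim: m u => [|m IH] u /=; first by exists s', t.
by move=> [v [w [/IH h3 h4 h5]]]; exists v, w.
Qed.

(** Compressed rewriting without a well-order: at ordinal 0 only chains of length 0 exist, and these
    are finite reductions. *)
Definition full0 s t := derivable (reds zero) (Full s t).
Definition lifted0 s t := derivable (reds zero) (Lifted s t).

Lemma squig_zero (W : wellorder) (x : W) m s t :
  is_zero x -> squig zero x m s t -> reds zero s t.
Proof.
by case: m => [//|m] hx [u [v [_ [y [/hx]]]]].
Qed.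

Lemma reds_squig (W : wellorder) (x : W) s t :
  reds zero s t -> exists m, squig zero x m s t.
Proof. by exists 0. Qed.

Lemma full0_rew (W : wellorder) (x : W) s t : full0 s t -> rew zero x s t.
Proof. exact: full_mono (@reds_squig W x). Qed.

Lemma lifted0_rew (W : wellorder) (x : W) s t :
  lifted0 s t -> rew_lifted zero x s t.
Proof. by rewrite rew_liftedE; apply: lifted_mono (@reds_squig W x). Qed.

Lemma rew_zero (W : wellorder) (x : W) s t :
  is_zero x -> rew zero x s t -> full0 s t.
Proof. by move=> hx; apply: full_mono => u v [m]; apply: squig_zero. Qed.

Lemma compressedE s t : compressed zero s t <-> full0 s t.
Proof. by split; [apply: rew_zero => -[] | apply: full0_rew]. Qed.

Lemma full0P s t : full0 s t <-> exists2 s', reds zero s s' & lifted0 s' t.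
Proof. exact: derivable_splitP. Qed.

Lemma reds_full0 s s' t : reds zero s s' -> full0 s' t -> full0 s t.
Proof.
move=> h /full0P [u h1 h2]; apply/full0P; exists u => //.
exact: reds_trans h1.
Qed.

Lemma lifted0_full0 s t : lifted0 s t -> full0 s t.
Proof. by move=> h; apply/full0P; exists s => //; apply: reds_refl. Qed.

Lemma reds_sub_full0 s t : reds zero s t -> full0 s t.
Proof.
by move=> h; apply/full0P; exists t => //; apply: lifted_refl => u; apply: reds_refl.
Qed.

Lemma rew_mono_below (W W' : wellorder) (x : W) (x' : W') s t :
  (forall y u v, wlt y x -> rew_lifted zero y u v ->
     exists2 y', wlt y' x' & rew_lifted zero y' u v) ->
  rew zero x s t -> rew zero x' s t.
Proof.
move=> h; apply: full_mono => u v [m hm]; exists m.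
apply: chain_mono hm => a b [y [hy ab]].
by have [y' hy' ?] := h _ _ _ hy ab; exists y', hy'.
Qed.

Lemma rew_liftedP (W : wellorder) (x : W) s t : rew_lifted zero x s t <->
  exists r ss ts, [/\ is_node r ss s, is_node r ts t &
    forall i, rew zero x (ss i) (ts i)].
Proof. rewrite rew_liftedE; exact: derivable_liftP. Qed.

Lemma rew_lifted_full0 (W : wellorder) (x : W) s t :
  (forall s t, rew zero x s t -> full0 s t) ->
  rew_lifted zero x s t -> lifted0 s t.
Proof.
move=> h /rew_liftedP [r [ss [ts [hs ht hi]]]]; apply/derivable_liftP.
by exists r, ss, ts; split=> // i; apply: h.
Qed.

Lemma bool_lt_wf : well_founded (fun x y : bool => ~~ x && y).
Proof.
have h0 : Acc (fun x y : bool => ~~ x && y) false.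
  by constructor=> y; rewrite andbF.
case; last exact: h0.
by constructor=> -[] // _; exact: h0.
Qed.

Definition bool_wellorder : wellorder.
Proof.
refine (@WellOrder bool (fun x y => ~~ x && y) _ _ bool_lt_wf).
- by move=> [] [] [].
- by move=> [] []; auto.
Defined.

(* Level 1 is enough: once the levels below [x] are compressed, [rew x] is
   contained in [rew 1]. *)
Lemma ordinal_compression_full0 : ordinal_compression zero ->
  forall (W : wellorder) (x : W) s t, rew zero x s t -> full0 s t.
Proof.
move=> oc W x; elim: {x}(wlt_wf W x) => x _ IH s t h.
apply/compressedE/oc; exists bool_wellorder, true; split.
  by exists nat_of_bool => -[] [].
apply: rew_mono_below h => y u v /IH hy /(rew_lifted_full0 hy) h.
by exists false => //; apply: lifted0_rew.
Qed.

Lemma ordinal_compression_Q : ordinal_compression zero -> Q zero.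
Proof.
move=> oc W x s t t' _ /(ordinal_compression_full0 oc) /full0P [s1 h1 h2] htt'.
exists s; split; first exact: reds_refl.
apply: full0_rew; apply: (ordinal_compression_full0 oc (x := true : bool_wellorder)).
(* The rewriting followed by the step is a rewriting at level 1, by a chain of length 1 through [s1]
   and [t] and a reflexive lifted rewriting of [t']. *)
apply/derivable_splitP; exists t'; last first.
  by apply: lifted_refl => u; exists 0; apply: reds_refl.
exists 1, s1, t; split=> //; last exact: rt_step.
by exists (false : bool_wellorder), isT; apply: lifted0_rew.
Qed.

(** The instance of [Q] at ordinal 0, with the initial finite reduction merged into the compressed
    rewriting. *)
Definition step_absorption :=
  forall s t t', full0 s t -> red zero t t' -> full0 s t'.

Lemma Q_step_absorption : Q zero -> step_absorption.
Proof.
move=> q s t t' h htt'.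
(* At ordinal 0 a chain is a finite reduction, so [P] holds through its disjunct [s'' = s']. *)
have p : P zero (tt : unit_wellorder).
  move=> n u v /squig_zero h'; exists v; split; last by left.
  by apply: h' => -[].
have [s' [h1 /(rew_zero (x := tt : unit_wellorder)) h2]] :=
  q _ _ _ _ _ p (full0_rew (tt : unit_wellorder) h) htt'.
by apply: reds_full0 h1 _; apply: h2 => -[].
Qed.

(** * Under step absorption all ordinal levels collapse to 0 *)

Section Absorption.
Hypothesis absorb : step_absorption.

Lemma full0_reds s t t' : full0 s t -> reds zero t t' -> full0 s t'.
Proof.
move=> h h'; elim/clos_refl_trans_ind_left: h' => // u v _ hu.
exact: absorb.
Qed.

Local Notation star := (clos_refl_trans_1n tree).

(** The reduction moves leftwards past one lifted rewriting at a time: absorption makes the pair a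
    compressed rewriting, which splits again into a reduction and a lifted rewriting. *)
Lemma star_lifted0_reds s t t' : star lifted0 s t -> reds zero t t' ->
  exists2 s', reds zero s s' & star lifted0 s' t'.
Proof.
elim=> [u h|u v w huv _ IH /IH [v' h1 h2]].
  by exists t' => //; constructor.
have /full0P [u' h3 h4] := full0_reds (lifted0_full0 huv) h1.
by exists u' => //; apply: Relation_Operators.rt1n_trans h4 h2.
Qed.

Lemma chain_lifted0 m s t : chain zero lifted0 m s t ->
  exists2 s', reds zero s s' & star lifted0 s' t.
Proof.
elim: m t => [|m IH] t /=; first by exists t => //; constructor.
move=> [u [v [/IH [s1 h1 h2] h3 h4]]].
have /full0P [u' h5 h6] := full0_reds (lifted0_full0 h3) h4.
have [s2 h7 h8] := star_lifted0_reds h2 h5.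
exists s2; first exact: reds_trans h7.
by apply: clos_rt_rt1n; apply: rt_trans (rt_step _ _ _ _ h6); apply: clos_rt1n_rt.
Qed.

(** All trees along the sequence have the same root rule, so lifted rewritings compose premiss by
    premiss. *)
Lemma star_lifted0_node s t r ts : star lifted0 s t -> is_node r ts t ->
  exists2 ss, is_node r ss s & forall i, star full0 (ss i) (ts i).
Proof.
elim=> [u h|u v w /derivable_liftP [r' [us [vs [hu hv h]]]] _ IH /IH [vs' hv' h']].
  by exists ts => // i; constructor.
have er := is_node_rule hv hv'; subst r'.
rewrite (is_node_children hv hv') in h.
by exists us => // i; apply: Relation_Operators.rt1n_trans (h i) (h' i).
Qed.

(** Each chain becomes a finite reduction followed by lifted rewritings; these are pushed into the
    premisses, where they are prepended to the next chain. *)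
Lemma chain_collapse s t :
  derivable (fun u v => exists m, chain zero lifted0 m u v) (Full s t) ->
  full0 s t.
Proof.
set B := fun u v => _; pose X u v := derivable B (Full u v).
have chain_star u v w : star full0 u v -> B v w -> B u w.
  elim=> // a b c /full0P [a' h1 h2] _ IH /IH [m hm].
  by exists m.+1; apply: chain_cons h2 hm.
have X_star u v w : star full0 u v -> X v w -> X u w.
  move=> h /derivable_splitP [v' h1 h2]; apply/derivable_splitP.
  by exists v' => //; apply: chain_star h1.
apply: (full_coind (X := X)) => {}s {}t /derivable_full_layer.
(* The extra source [s0] carries the rewritings pushed down from above through the inductive part of
   the layer. *)
suff: full_layer B X s t ->
    forall s0, star full0 s0 s -> full_layer (reds zero) X s0 t.
  by move=> h /h; apply; constructor.
elim=> {}s {}t s' r ss ts hb hs ht hc _ IH s0 /chain_star /(_ hb) [m].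
move=> /chain_lifted0 [s1 h1 h2].
have [ss1 hs1 h] := star_lifted0_node h2 hs.
apply: (FullLayer h1 hs1 ht) => i hi; first exact: X_star (h i) (hc i hi).
exact: IH.
Qed.

Lemma rew_full0 (W : wellorder) (x : W) s t : rew zero x s t -> full0 s t.
Proof.
elim: {x}(wlt_wf W x) s t => x _ IH s t h; apply: chain_collapse.
apply: full_mono h => u v [m hm]; exists m.
apply: chain_mono hm => a b [y [/IH hy]]; exact: rew_lifted_full0.
Qed.

Lemma absorption_ordinal_compression : ordinal_compression zero.
Proof.
move=> s t; split=> [[W [x [_ /rew_full0 /compressedE]]] //|h].
exists unit_wellorder, tt; split=> //.
by exists (fun=> 0) => y z [].
Qed.

End Absorption.

End Judgments.

(** * Truncation and the metric *)

Section Truncation.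
Variables (St D : Type) (rl : D -> rule St).
Local Notation tree := (derivation rl).
Implicit Types s t : tree.

Lemma trunc_conclusion n s t :
  trunc rl n s = trunc rl n t -> conclusion s = conclusion t.
Proof.
move=> /(congr1 (fun l => l [::])); rewrite /conclusion.
by case: n => [|n] /=; case: (s [::]) => [[c r]|]; case: (t [::]) => [[c' r']|] //= [->].
Qed.

Lemma trunc0P s t : trunc rl 0 s = trunc rl 0 t <-> conclusion s = conclusion t.
Proof.
split=> [|e]; first exact: trunc_conclusion.
apply: functional_extensionality; move: e; rewrite /conclusion.
case e: (s [::]) (lab_root (d := s)) => [[c r]|] // _.
case e': (t [::]) (lab_root (d := t)) => [[c' r']|] // _ [ec].
by case=> [|i p] /=; rewrite e e' ?ec.
Qed.

Lemma trunc_node n s t r ss : is_node r ss s ->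
  trunc rl n.+1 s = trunc rl n.+1 t -> exists ts, is_node r ts t.
Proof.
move=> [[c e] _] /(congr1 (fun l => l [::])) /=; rewrite e.
have [r' [ts ht]] := node_ex t; case: (ht) => [[c' ->] _] [_ ->].
by exists ts.
Qed.

Lemma trunc_child n s r ss (i : 'I_(arity (rl r))) p : is_node r ss s ->
  trunc rl n.+1 s (val i :: p) = trunc rl (n.+1 - coind (rl r) i) (ss i) p.
Proof.
move=> [[c e] es] /=; rewrite e /coind_at valK /=; congr trunc.
exact: functional_extensionality (es i).
Qed.

Lemma trunc_nodeP n s t r ss ts : is_node r ss s -> is_node r ts t ->
  trunc rl n.+1 s = trunc rl n.+1 t <->
  conclusion s = conclusion t /\ forall i,
    trunc rl (n.+1 - coind (rl r) i) (ss i) =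
    trunc rl (n.+1 - coind (rl r) i) (ts i).
Proof.
move=> hs ht; split=> [e|[ec e]].
  split=> [|i]; first exact: trunc_conclusion e.
  apply: functional_extensionality => p.
  by rewrite -(trunc_child _ _ _ hs) -(trunc_child _ _ _ ht) e.
apply: functional_extensionality => -[|i p].
  move: ec; rewrite /conclusion /=.
  by case: hs ht => [[c ->] _] [[c' ->] _] /= [->].
case: (ltnP i (arity (rl r))) => hi.
  by rewrite -[i]/(val (Ordinal hi)) (trunc_child _ _ _ hs) (trunc_child _ _ _ ht) e.
have none (u : tree) us : is_node r us u -> trunc rl n.+1 u (i :: p) = None.
  move=> [[c eu] _]; have [f [_ /(_ i)]] := lab_local eu.
  rewrite /= eu insubF; last by rewrite ltnNge hi.
  by rewrite /=; case e': (u [:: i]) => // _; case: p => [|j p] /=; rewrite e'.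
by rewrite (none _ _ hs) (none _ _ ht).
Qed.

(** Induction on [n], and inside it along non-coinductive premisses, since those leave the
    truncation depth unchanged. *)
Lemma trunc_le n m s t : n <= m ->
  trunc rl m s = trunc rl m t -> trunc rl n s = trunc rl n t.
Proof.
elim: n m s t => [|n IHn] m s t hnm e.
  by apply/trunc0P; apply: trunc_conclusion e.
case: m hnm e => // m hnm; elim: (derivation_wf s) t => {}s r ss hs _ IH t e.
have [ts ht] := trunc_node hs e.
apply/(trunc_nodeP _ hs ht); case/(trunc_nodeP _ hs ht): e => ec e.
split=> // i; case: (boolP (coind (rl r) i)) (IH i) (e i) => hc IHi.
  by rewrite /= !subn1 /=; apply: IHn.
by rewrite /= !subn0; apply: IHi.
Qed.

(** Agreement at depth [n.+1] gives agreement of the subtrees at depth at least [n], so induction on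
    positions reaches every label. *)
Lemma trunc_ext s t : (forall n, trunc rl n s = trunc rl n t) -> s = t.
Proof.
move=> h; apply: tree_ext => p; elim: p s t h => [|i p IH] s t h.
  move: (h 1) => /(congr1 (fun l => l [::])) /=.
  case: (s [::]) (lab_root (d := s)) => [[c r]|] // _.
  by case: (t [::]) (lab_root (d := t)) => [[c' r']|] // _ [-> ->].
have [r [ss hs]] := node_ex s; have [ts ht] := trunc_node hs (h 1).
case: (ltnP i (arity (rl r))) => hi.
  rewrite -[i]/(val (Ordinal hi)); case: (hs) (ht) => [_ ->] [_ ->].
  apply: IH => n; have [_ /(_ (Ordinal hi))] := (trunc_nodeP n hs ht).1 (h n.+1).
  by apply: trunc_le; case: (coind _ _); rewrite ?subn1 ?subn0.
have none (u : tree) us : is_node r us u -> u (i :: p) = None.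
  move=> [[c eu] _]; have [f [_ /(_ i)]] := lab_local eu.
  rewrite insubF; last by rewrite ltnNge hi.
  rewrite /= => e; rewrite -cat1s; apply: lab_undef.
  by move: e; case: (u _).
by rewrite (none _ _ hs) (none _ _ ht).
Qed.

Lemma half_pow_gt0 n : (0 < (/ 2) ^ n)%R.
Proof. by apply: pow_lt; lra. Qed.

Lemma half_pow_le n m : n <= m -> ((/ 2) ^ m <= (/ 2) ^ n)%R.
Proof.
move=> /subnKC <-; rewrite -plusE pow_add.
have := half_pow_gt0 n; have : ((/ 2) ^ (m - n) <= 1)%R.
  by rewrite -(pow1 (m - n)); apply: pow_incr; lra.
by move=> *; nra.
Qed.

(** If the truncations at [n] differ, the trees agree at no depth above [n], so the infimum is at
    least [2^-n]. *)
Lemma dist_lt_trunc n s t :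
  Rbar_lt (dist s t) (Finite ((/ 2) ^ n)%R) -> trunc rl n s = trunc rl n t.
Proof.
move=> hlt; apply: NNPP => hn; apply: (Rbar_lt_not_le _ _ hlt).
apply: (proj2 (Glb_Rbar_correct _)) => _ [d [e ->]] /=.
apply: half_pow_le; rewrite leqNgt; apply/negP => /ltnW hd.
exact/hn/(trunc_le hd).
Qed.

Lemma trunc_dist_lt (e : R) : (0 < e)%R -> exists n, forall s t,
  trunc rl n s = trunc rl n t -> Rbar_lt (dist s t) (Finite e).
Proof.
move=> he; have h2 : (Rabs (/ 2) < 1)%R by rewrite Rabs_pos_eq; lra.
have [n hn] := pow_lt_1_zero _ h2 _ he.
exists n => s t est; apply: (Rbar_le_lt_trans _ (Finite ((/ 2) ^ n)%R)).
  by apply: (proj1 (Glb_Rbar_correct _)); exists n.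
have := hn n (Nat.le_refl n); rewrite Rabs_pos_eq //.
exact/Rlt_le/half_pow_gt0.
Qed.

End Truncation.

(** * Elementary facts on well-orders *)

Section WellOrder.
Variable W : wellorder.
Implicit Types x y z : W.

Lemma wlt_irr x : ~ wlt x x.
Proof. by elim: {x}(wlt_wf W x) => x _ IH h; apply: (IH _ h h). Qed.

Lemma wle_lt_trans x y z : wle x y -> wlt y z -> wlt x z.
Proof. by case=> [->|] // h1 h2; apply: wlt_trans h1 h2. Qed.

Lemma wlt_le_trans x y z : wlt x y -> wle y z -> wlt x z.
Proof. by move=> h1 [<-|] // h2; apply: wlt_trans h1 h2. Qed.

Lemma wle_trans x y z : wle x y -> wle y z -> wle x z.
Proof. by move=> [-> //|h] h'; right; apply: wlt_le_trans h h'. Qed.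

Lemma wleNlt x y : ~ wlt x y -> wle y x.
Proof. by case: (wlt_total x y) => [//|[->|h]] _; [left | right]. Qed.

Lemma wmax x y z : wlt x z -> wlt y z -> exists2 m, wlt m z & wle x m /\ wle y m.
Proof.
case: (wlt_total x y) => [h|[->|h]] hx hy.
- by exists y => //; split; [right | left].
- by exists y => //; split; left.
- by exists x => //; split; [left | right].
Qed.

Lemma limit_between l x : is_limit l -> wlt x l -> exists2 y, wlt x y & wlt y l.
Proof.
move=> [_ h] hx; apply: NNPP => hn; apply: (h x); split=> // z h1 h2.
by apply: hn; exists z.
Qed.

Lemma wellorder_cases x : [\/ is_zero x, exists y, is_succ y x | is_limit x].
Proof.
case: (classic (is_zero x)) => [|h]; first by constructor 1.
case: (classic (exists y, is_succ y x)) => [|h']; first by constructor 2.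
by constructor 3; split=> // y hy; apply: h'; exists y.
Qed.

End WellOrder.

(** * Strongly converging sequences are compressed *)

Section Sequences.
Variables (St D : Type) (rl : D -> rule St).
Local Notation tree := (derivation rl).
Implicit Types s t : tree.
Variable zero : tree -> tree -> Prop.

Definition converges_at (W : wellorder) (u : W -> tree) (d : W -> nat) (l : W) :=
  forall n, exists2 b, wlt b l & forall x, wlt b x -> wlt x l ->
    trunc rl n (u x) = trunc rl n (u l) /\ n <= d x.

Lemma strongly_convergingP (W : wellorder) (g : W) u d :
  strongly_converging zero g u d <->
  (forall x y, is_succ x y -> wle y g -> step zero (d x) (u x) (u y)) /\
  (forall l, is_limit l -> wle l g -> converges_at u d l).
Proof.
split=> -[h1 h2]; split=> // l hl hlg.
  have [hu hd] := h2 _ hl hlg => n.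
  have [b hb hbu] := hu _ (half_pow_gt0 n); have [b' hb' hbd] := hd n.
  have [m hm [hbm hbm']] := wmax hb hb'; exists m => // x hmx hxl; split.
    by apply: dist_lt_trunc; apply: hbu => //; apply: wle_lt_trans hmx.
  by apply: hbd => //; apply: wle_lt_trans hmx.
have hc := h2 _ hl hlg; split=> [e /(trunc_dist_lt rl) [n hn]|n].
  by have [b hb hx] := hc n; exists b => // x h h'; apply/hn; case: (hx x h h').
by have [b hb hx] := hc n; exists b => // x h h'; case: (hx x h h').
Qed.

Lemma stepP d s t : step zero d s t <->
  (d = 0 /\ zero s t) \/
  exists r ss ts (i : 'I_(arity (rl r))) d',
    [/\ d = d' + coind (rl r) i, is_node r ss s, is_node r ts t,
        step zero d' (ss i) (ts i) & forall j, j <> i -> ts j = ss j].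
Proof.
split=> [[{}s {}t h|r ss ts i d' {}s {}t hs ht h1 h2]|].
- by left.
- by right; exists r, ss, ts, i, d'.
case=> [[-> h]|[r [ss [ts [i [d' [-> hs ht h1 h2]]]]]]].
  exact: step_zero.
exact: (step_ctx hs ht).
Qed.

(* Allowing idle steps, a sequence of trees with the same root restricts to its
   immediate subtrees without reindexing. *)
Definition idling_converging (W : wellorder) (b g : W) (u : W -> tree) d :=
  (forall x y, is_succ x y -> wle b x -> wle y g ->
     step zero (d x) (u x) (u y) \/ u x = u y) /\
  (forall l, is_limit l -> wlt b l -> wle l g -> converges_at u d l).

Lemma idling_sub (W : wellorder) (b b' g g' : W) u d :
  wle b b' -> wle g' g ->
  idling_converging b g u d -> idling_converging b' g' u d.
Proof.
move=> hb hg [h1 h2]; split=> [x y hs hx hy|l hl hbl hlg].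
  by apply: h1 => //; [apply: wle_trans hx|apply: wle_trans hg].
by apply: h2 => //; [apply: wle_lt_trans hbl|apply: wle_trans hg].
Qed.

(** A step of positive depth takes place inside one premiss: it is a step of that subtree and idle
    in all others. *)
Lemma idling_child (W : wellorder) (b g : W) u d r
    (us : W -> 'I_(arity (rl r)) -> tree) i :
  (forall x, wle b x -> wle x g -> is_node r (us x) (u x)) ->
  (forall x, wle b x -> wlt x g -> 0 < d x) ->
  idling_converging b g u d ->
  idling_converging b g (us^~ i) (fun x => d x - coind (rl r) i).
Proof.
move=> hus hd [h1 h2]; split=> [x y hs hx hy|l hl hbl hlg].
  have hxg : wlt x g by case: hs => h _; apply: wlt_le_trans hy.
  have nx : is_node r (us x) (u x) by apply: hus => //; right.
  have ny : is_node r (us y) (u y).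
    by apply: hus => //; right; case: hs => h _; apply: wle_lt_trans h.
  case: (h1 _ _ hs hx hy) => [/stepP|e]; last first.
    by right; rewrite e in nx; rewrite (is_node_children nx ny).
  case=> [[e _]|[r' [ss [ts [j [d' [e ns nt st eq]]]]]]].
    by have := hd x hx hxg; rewrite e.
  have er := is_node_rule nx ns; subst r'.
  rewrite (is_node_children nx ns) (is_node_children ny nt) e.
  case: (classic (i = j)) => [->|/eq ->]; last by right.
  by left; rewrite addnK.
(* Passing to a coinductive premiss loses one level, hence [n.+1]; the bound [m] is at least [b], so
   that [hus] applies beyond it. *)
move=> n; have [c hc hx] := h2 _ hl hbl hlg n.+1.
have [m hm [hcm hbm]] := wmax hc hbl; exists m => // x hmx hxl.
have [|e hnd] := hx x _ hxl; first exact: wle_lt_trans hmx.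
have nx : is_node r (us x) (u x).
  by apply: hus; right; [apply: wle_lt_trans hmx | apply: wlt_le_trans hlg].
have nl : is_node r (us l) (u l) by apply: hus => //; right.
have [_ /(_ i) ei] := (trunc_nodeP _ nx nl).1 e; split.
  by apply: trunc_le ei; case: (coind _ _); rewrite ?subn1 ?subn0.
case: (coind _ _); last by rewrite subn0 ltnW.
by rewrite subn1 -ltnS (ltn_predK hnd).
Qed.

Section Absorption.
Hypothesis absorb : step_absorption zero.

(** Truncation at depth 1 shows everything above the first coinductive premisses. There the sequence
    is constant, so the layer for [u b] carries over to [u g], and a sequence remains for each
    coinductive premiss. *)
Lemma full_layer_idling (W : wellorder) (b g : W) u d s v :
  wlt b g -> u b = v -> idling_converging b g u d ->
  (forall x, wle b x -> wlt x g ->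
     trunc rl 1 (u x) = trunc rl 1 (u g) /\ 0 < d x) ->
  full_layer (reds zero) (full0 zero) s v ->
  full_layer (reds zero) (fun s t => exists (u : W -> tree) d,
    [/\ idling_converging b g u d, full0 zero s (u b) & u g = t]) s (u g).
Proof.
move=> hbg eu hi hroot h.
elim: h u d eu hi hroot => {}s {}v s' r ss vs hs ns nv hc _ IH u d eu hi hroot.
have hnode x : wle b x -> wle x g -> exists us, is_node r us (u x).
  have [e _] := hroot b (or_introl erefl) hbg; rewrite -eu in nv.
  have [ws nw] := trunc_node nv e.
  move=> hx [->|hxg]; first by exists ws.
  by have [/esym ex _] := hroot x hx hxg; apply: trunc_node nw ex.
have /choice [us hus] : forall x, exists us : 'I_(arity (rl r)) -> tree,
    wle b x -> wle x g -> is_node r us (u x).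
  move=> x; case: (classic (wle b x /\ wle x g)) => [[h1 h2]|h].
    by have [ws nw] := hnode x h1 h2; exists ws.
  by exists vs => h1 h2; case: h.
have ng : is_node r (us g) (u g) by apply: hus; [right|left].
have eb : us b = vs.
  by apply: is_node_children nv; rewrite -eu; apply: hus; [left|right].
have hch := idling_child _ hus (fun x h1 h2 => (hroot x h1 h2).2) hi.
apply: (FullLayer hs ns ng) => i hci.
  exists (us^~ i), (fun x => d x - coind (rl r) i); split=> //.
  by rewrite eb; apply: hc.
apply: (IH i hci (us^~ i) d) => //; first by rewrite eb.
  have := hch i; rewrite (negbTE hci).
  by congr idling_converging; apply: functional_extensionality => x; rewrite subn0.
move=> x h1 h2; have [e hd] := hroot x h1 h2; split=> //.
have [|_ /(_ i)] := (trunc_nodeP _ (hus x h1 _) ng).1 e; first by right.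
by rewrite (negbTE hci) subn0.
Qed.

(** Transfinite induction on the end [g]: absorption handles successors, coinduction handles
    limits. *)
Lemma full0_idling (W : wellorder) (b g : W) u d s :
  wle b g -> idling_converging b g u d -> full0 zero s (u b) ->
  full0 zero s (u g).
Proof.
elim: {g}(wlt_wf W g) b u d s => g _ IH b u d s [-> //|hbg] hi hs.
case: (wellorder_cases g) => [/(_ b) //|[y hy]|hg].
  have hby : wle b y by apply: wleNlt => /hy.2.
  have hyg : wle y g by right; case: hy.
  have := IH y hy.1 b u d s hby (idling_sub (or_introl erefl) hyg hi) hs.
  case: (hi.1 _ _ hy hby (or_introl erefl)) => [h|<- //] h'.
  by apply: absorb h' _; exists (d y).
(* The invariant fixes the limit [g] but lets the start and the sequence vary, as it must also cover
   tails restricted to subtrees. *)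
pose X s t := exists c (v : W -> tree) e, [/\ wlt c g, idling_converging c g v e,
  full0 zero s (v c) & v g = t].
apply: (full_coind (X := X)) => [t w|]; last by exists b, u, d.
move=> [c [v [e [hc hv ht <-]]]].
have [b' hb' hx] := hv.2 _ hg hc (or_introl erefl) 1.
have [m hm [hbm hcm]] := wmax hb' hc.
(* From [z] on, steps have positive depth and the depth-1 truncation is stable; the segment up to
   [z] is compressed by induction. *)
have [z hmz hzg] := limit_between hg hm.
have hcz : wle c z by right; apply: wle_lt_trans hmz.
have htz : full0 zero t (v z).
  apply: (IH z hzg c v e) => //.
  by apply: idling_sub hv; [left | right].
have h1 : forall x, wle z x -> wlt x g ->
    trunc rl 1 (v x) = trunc rl 1 (v g) /\ 0 < e x.
  move=> x hzx; apply: hx; apply: wle_lt_trans hbm _.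
  exact: wlt_le_trans hzx.
have := full_layer_idling hzg erefl (idling_sub hcz (or_introl erefl) hv) h1
  (derivable_full_layer htz).
apply: full_layer_mono => // p q [v' [e' [h2 h3 h4]]].
by exists z, v', e'.
Qed.

Lemma red_infty_full0 s t : red_infty zero s t -> full0 zero s t.
Proof.
move=> [W [o [g [u [d [ho <- <- /strongly_convergingP [h1 h2]]]]]]].
apply: (full0_idling (b := o) (d := d)).
- by apply: wleNlt => /ho.
- split=> [x y hs _ hy|l hl _ hlg]; first by left; apply: h1.
  exact: h2.
- by apply: full_refl => v; apply: reds_refl.
Qed.

End Absorption.
End Sequences.

(** * Appending a step to a strongly converging sequence *)

Section TopAfter.
Variables (W : wellorder) (g : W).

(* [None] is inserted right after [g]. *)
Definition insert_lt (x y : option W) : Prop :=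
  match x, y with
  | Some a, Some b => wlt a b
  | Some a, None => wle a g
  | None, Some b => wlt g b
  | None, None => False
  end.

Lemma insert_lt_trans x y z : insert_lt x y -> insert_lt y z -> insert_lt x z.
Proof.
case: x y z => [a|] [b|] [c|] //=.
- exact: wlt_trans.
- by move=> h [<-|h']; right => //; apply: wlt_trans h h'.
- exact: wle_lt_trans.
- by move=> h h'; apply: wlt_trans h h'.
- by move=> h h'; case: (wlt_irr (wlt_le_trans h h')).
Qed.

Lemma insert_lt_total x y : insert_lt x y \/ x = y \/ insert_lt y x.
Proof.
case: x y => [a|] [b|] /=; last by right; left.
- by case: (wlt_total a b) => [|[->|]]; auto.
- by case: (wlt_total a g) => [|[->|]]; rewrite /wle; auto.
- by case: (wlt_total b g) => [|[->|]]; rewrite /wle; auto.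
Qed.

(** Accessibility comes in three stages: elements up to [g], then [None], then the remaining
    elements. *)
Lemma insert_lt_wf : well_founded insert_lt.
Proof.
have h1 a : wle a g -> Acc insert_lt (Some a).
  elim: {a}(wlt_wf W a) => a _ IH hag; constructor=> -[b|] /= h.
    by apply: IH => //; right; apply: wlt_le_trans hag.
  by case: (wlt_irr (wlt_le_trans h hag)).
have h2 : Acc insert_lt None by constructor=> -[b /h1|[]].
case=> [a|]; last exact: h2.
elim: {a}(wlt_wf W a) => a _ IH; constructor=> -[b /IH|_]; first exact.
exact: h2.
Qed.

Definition insert_wellorder : wellorder :=
  WellOrder insert_lt_trans insert_lt_total insert_lt_wf.

End TopAfter.

Section Append.
Variables (St D : Type) (rl : D -> rule St).
Local Notation tree := (derivation rl).
Variable zero : tree -> tree -> Prop.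

Lemma red_infty_refl (s : tree) : red_infty zero s s.
Proof.
exists unit_wellorder, tt, tt, (fun=> s), (fun=> 0); split=> // [[]|] //.
split=> [x y [] //|l [h _]].
by case: h => y [].
Qed.

Lemma red_infty_red (s t t' : tree) :
  red_infty zero s t -> red zero t t' -> red_infty zero s t'.
Proof.
move=> [W [o [g [u [d [ho <- <- [h1 h2]]]]]]] [e he].
pose W' := insert_wellorder g.
pose u' (x : W') : tree := if x is Some a then u a else t'.
(* The new step starts at [g], so its depth [e] replaces [d g]; the value 0 at [None] is a dummy. *)
pose d' (x : W') := if x is Some a then if excluded_middle_informative (a = g)
  then e else d a else 0.
have hd' a : wlt a g -> d' (Some a) = d a.
  rewrite /d'; case: excluded_middle_informative => // ag h.
  by rewrite ag in h; case: (wlt_irr h).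
exists W', (Some o), None, u', d'; split=> //.
  by case=> [y|] /=; [apply: ho | apply: ho].
(* Insertion after [g] creates no limit up to [g], so convergence there is inherited. *)
have limE (l : W) : wle l g -> is_limit (Some l : W') -> is_limit l.
  move=> hlg [hz hs]; split=> [hz'|y [hy hs']].
    apply: hz => -[y|] /=; first exact: hz'.
    by move=> h; apply: (wlt_irr (wlt_le_trans h hlg)).
  apply: (hs (Some y)); split=> // -[z|] /= h h'; first exact: (hs' z).
  by apply: (wlt_irr (wlt_le_trans h' hlg)).
split.
  case=> [a|] [b|] [hab hs] hb //=.
  - have hbg : wle b g by case: hb.
    have hag : wlt a g by apply: wlt_le_trans hbg.
    rewrite -/(d' (Some a)) hd' //; apply: h1 => //.
    by split=> // z h h'; apply: (hs (Some z)).
  - have -> : a = g.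
      case: hab => // h; case: (hs (Some g)) => //; by left.
    by case: excluded_middle_informative.
  - case: hb => //= hb; case: hb => e'.
      by subst b; case: (wlt_irr hab).
    by case: (wlt_irr (wlt_trans (hab : wlt g b) e')).
case=> [l|] hl hlg; last first.
  case: hl => _ /(_ (Some g)) []; split=> [|[z|] /= h h'] //; first by left.
  exact: wlt_irr (wlt_le_trans h h').
have {}hlg : wle l g by case: hlg.
have [hu hd] := h2 _ (limE _ hlg hl) hlg; split.
  move=> e' /hu [b hb hx]; exists (Some b) => // -[x|] /= hbx hxl.
    exact: hx.
  by case: (wlt_irr (wlt_le_trans hxl hlg)).
move=> n; have [b hb hx] := hd n; exists (Some b) => // -[x|] /= hbx hxl.
  by rewrite -/(d' (Some x)) hd'; [exact: hx | exact: wlt_le_trans hlg].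
by case: (wlt_irr (wlt_le_trans hxl hlg)).
Qed.

Lemma reds_red_infty (s t : tree) : reds zero s t -> red_infty zero s t.
Proof.
move=> h; elim/clos_refl_trans_ind_left: h => [|u v _ hu huv].
  exact: red_infty_refl.
exact: red_infty_red huv.
Qed.

(** The step is appended to a strongly converging sequence for the compressed rewriting, and the
    result is compressed again. *)
Lemma compression_absorption : compression zero -> step_absorption zero.
Proof.
move=> c s t t' /compressedE /c h /(red_infty_red h) /c.
by move=> /compressedE.
Qed.

End Append.

(** * Compressed rewritings unfold to sequences of length at most omega *)

Section Approximation.
Variables (St D : Type) (rl : D -> rule St).
Local Notation tree := (derivation rl).
Implicit Types s t : tree.
Variable zero : tree -> tree -> Prop.
Hypothesis preserved : preserves_conclusions zero.

Lemma full0_conclusion s t : full0 zero s t -> conclusion s = conclusion t.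
Proof. by move/compressedE; apply: preserved. Qed.

Lemma step_conclusion d s t : step zero d s t -> conclusion s = conclusion t.
Proof.
move=> h; apply/full0_conclusion/reds_sub_full0/rt_step.
by exists d.
Qed.

(** Nodes above the contracted subtree keep their rules and, as conclusions are preserved, their
    statements. *)
Lemma step_trunc d s t : step zero d s t -> trunc rl d s = trunc rl d t.
Proof.
move=> h; move: (step_conclusion h).
elim: h => [{}s {}t _ /trunc0P //|r ss ts i {}d {}s {}t hs ht h IH eq ec].
case en: (d + coind (rl r) i) => [|n]; first exact/trunc0P.
apply/(trunc_nodeP _ hs ht); split=> // j.
case: (classic (j = i)) => [->|/eq -> //].
by rewrite -en addnK; apply/IH/step_conclusion/h.
Qed.

Inductive steps (n : nat) : nat -> tree -> tree -> Prop :=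
| steps0 s : steps n 0 s s
| stepsS k d s t u :
    n <= d -> step zero d s t -> steps n k t u -> steps n k.+1 s u.

Definition deep n s t := exists k, steps n k s t.

Lemma deep_refl n s : deep n s s.
Proof. by exists 0; constructor. Qed.

Lemma deep_trans n s t u : deep n s t -> deep n t u -> deep n s u.
Proof.
move=> [k h] [l h']; elim: h h' => {k} [v hv|k d s1 s2 s3 hn hs _ IH /IH [m hm]].
  by exists l.
by exists m.+1; apply: stepsS hn hs hm.
Qed.

Lemma deep_le n m s t : n <= m -> deep m s t -> deep n s t.
Proof.
move=> hnm [k h]; exists k; elim: h => [u|{}k d s1 s2 s3 hm hs _]; first exact: steps0.
by apply: stepsS hs; apply: leq_trans hm.
Qed.

Lemma deep_step n d s t : n <= d -> step zero d s t -> deep n s t.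
Proof. by move=> hn h; exists 1; apply: stepsS hn h (steps0 _ _). Qed.

Lemma deep_trunc n s t : deep n s t -> trunc rl n s = trunc rl n t.
Proof.
move=> [k h]; elim: h => // {}k d s1 s2 s3 hn hs _ <-.
exact/(trunc_le hn)/step_trunc/hs.
Qed.

Lemma reds_deep s t : reds zero s t -> deep 0 s t.
Proof.
move=> h; elim/clos_refl_trans_ind_left: h => [|u v _ hu [d huv]].
  exact: deep_refl.
by apply: deep_trans hu _; apply: deep_step huv.
Qed.

(** The surrounding node is rebuilt after every step, which is possible since steps preserve
    conclusions. *)
Lemma steps_ctx r (us : 'I_(arity (rl r)) -> tree) t i n b :
  is_node r us t -> deep (n - coind (rl r) i) (us i) b ->
  exists2 t', is_node r (fun j => if j == i then b else us j) t' & deep n t t'.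
Proof.
move=> + [k h]; move ea: (us i) h => a h.
elim: h us t ea => [{}a|{}k d {}a a' {}b hn h _ IH] us t ea ht.
  exists t; last exact: deep_refl.
  suff <- : us = fun j => if j == i then a else us j by [].
  by apply: functional_extensionality => j; case: eqP => // ->.
have [|t1 ht1] := node_replace (ss' := fun j => if j == i then a' else us j) ht.
  by move=> j; case: eqP => // ->; rewrite ea; apply/esym/step_conclusion/h.
have [|t' ht' h'] := IH _ _ _ ht1; first by rewrite eqxx.
exists t'.
  move: ht'; congr (is_node _ _ _); apply: functional_extensionality => j.
  by case: eqP.
apply: deep_trans h'; apply: (@deep_step _ (d + coind (rl r) i)).
  by rewrite addnC -leq_subLR.
apply: (step_ctx ht ht1); first by rewrite ea eqxx.
by move=> j /eqP/negbTE ->.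
Qed.

Lemma deep_ctx n r (ss ts : 'I_(arity (rl r)) -> tree) s :
  is_node r ss s -> (forall i, deep (n - coind (rl r) i) (ss i) (ts i)) ->
  exists2 t, is_node r ts t & deep n s t.
Proof.
move=> hs h.
have H (l : seq 'I_(arity (rl r))) :
    exists2 t, is_node r (fun i => if i \in l then ts i else ss i) t & deep n s t.
  elim: l => [|i l [t ht hst]].
    by exists s => //; apply: deep_refl.
  have hi : deep (n - coind (rl r) i) (if i \in l then ts i else ss i) (ts i).
    by case: ifP => _ //; apply: deep_refl.
  have [t' ht' h'] := steps_ctx ht hi; exists t'; last exact: deep_trans h'.
  move: ht'; congr (is_node _ _ _); apply: functional_extensionality => j.
  by rewrite inE; case: eqP => // ->.
have [t ht hst] := H (enum 'I_(arity (rl r))); exists t => //.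
move: ht; congr (is_node _ _ _); apply: functional_extensionality => j.
by rewrite mem_enum.
Qed.

(** The trees agree down to depth [n], and compressed rewritings are left to perform at that
    frontier. *)
Inductive approx : nat -> tree -> tree -> Prop :=
| approx0 s t : full0 zero s t -> approx 0 s t
| approxS n r ss ts s t : is_node r ss s -> is_node r ts t ->
    (forall i, approx (n.+1 - coind (rl r) i) (ss i) (ts i)) ->
    approx n.+1 s t.

Lemma approx_trunc n s t : approx n s t -> trunc rl n s = trunc rl n t.
Proof.
elim=> {n s t} [s t /full0_conclusion /trunc0P //|n r ss ts s t hs ht _ IH].
apply/(trunc_nodeP _ hs ht); split=> //.
by apply: (is_node_conclusion ht hs) => i; apply: trunc_conclusion (IH i).
Qed.

(** One layer is unfolded at the frontier: its finite reductions happen at depth at least [n], and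
    its coinductive premisses form the new frontier. *)
Lemma approx_step n s t : approx n s t ->
  exists2 s', deep n s s' & approx n.+1 s' t.
Proof.
elim=> {n s t} [s t /derivable_full_layer|n r ss ts s t hs ht _ IH].
  elim=> {}s {}t s' r ss ts h hs ht hc _ IH.
  have /choice [us hus] : forall i, exists u,
      deep 0 (ss i) u /\ approx (1 - coind (rl r) i) u (ts i).
    move=> i; case: (boolP (coind (rl r) i)) (hc i) (IH i) => hci hi IHi.
      by exists (ss i); split; [apply: deep_refl | apply/approx0/hi].
    by have [u h1 h2] := IHi isT; exists u.
  have [|u hu hsu] := deep_ctx (n := 0) (ts := us) hs.
    by move=> i; rewrite sub0n; case: (hus i).
  exists u; first by apply: deep_trans (reds_deep h) hsu.
  by apply: (approxS hu ht) => i; case: (hus i).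
have /choice [us hus] : forall i, exists u,
    deep (n.+1 - coind (rl r) i) (ss i) u /\
    approx (n.+1 - coind (rl r) i).+1 u (ts i).
  by move=> i; have [u h1 h2] := IH i; exists u.
have [|u hu hsu] := deep_ctx (n := n.+1) (ts := us) hs.
  by move=> i; case: (hus i).
exists u => //; apply: (approxS hu ht) => i.
by rewrite subSn; [case: (hus i) | case: (coind _ _)].
Qed.

Lemma approx_iter n m s t : n <= m -> approx n s t ->
  exists2 s', deep n s s' & approx m s' t.
Proof.
move=> /subnKC <- h; elim: (m - n) => [|k [s' h1 /approx_step [s2 h2 h3]]].
  by exists s; [apply: deep_refl | rewrite addn0].
exists s2; last by rewrite addnS.
by apply: deep_trans h1 _; apply: deep_le h2; apply: leq_addr.
Qed.

(** If no unfolding ever took a step, [s] and [t] would agree at every depth. *)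
Lemma approx_advance n s t : approx n s t -> s <> t ->
  exists m k s', [/\ n < m, steps n k.+1 s s' & approx m s' t].
Proof.
move=> h ne; apply: NNPP => hn; apply/ne/trunc_ext => k.
(* [n.+1] makes the level grow strictly, [k] reaches the depth under test. *)
have hle : n <= maxn n.+1 k by rewrite ltnW // leq_maxl.
have [s' [[|l] h1] h2] := approx_iter hle h.
  inversion h1; subst s'; apply: trunc_le (approx_trunc h2); exact: leq_maxr.
by case: hn; exists (maxn n.+1 k), l, s'; rewrite leq_maxl.
Qed.

(** A position in the infinite sequence: [current] is under way to [target] by [remaining.+1] steps
    of depth at least [level], and [target] approximates the limit to depth [next_level]. *)
Record stage := Stage {
  level : nat; next_level : nat; remaining : nat; current : tree; target : tree
}.

Definition valid (s t : tree) (x : stage) :=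
  [/\ reds zero s (current x), level x < next_level x,
      steps (level x) (remaining x).+1 (current x) (target x)
    & approx (next_level x) (target x) t].

Definition advances (x y : stage) :=
  (level x = level y /\ remaining x = (remaining y).+1) \/ level x < level y.

Lemma valid_next s t x : ~ reds zero s t -> valid s t x ->
  exists y d, [/\ valid s t y, advances x y, level x <= d
    & step zero d (current x) (current y)].
Proof.
move=> hn; case: x => n m k a b [/= ha hnm hs hb].
inversion hs as [|k' d a' c b' hd hac hcb]; subst a' b' k'.
have hc : reds zero s c by apply: rt_trans ha (rt_step _ _ _ _ _); exists d.
case: k hs hcb => [|k] hs hcb; last first.
  by exists (Stage n m k c b), d; split=> //; left.
inversion hcb; subst b.
(* The block is exhausted; as [t] is out of reach of finite reductions, its end differs from [t] and
   a block of higher level follows. *)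
have [|m' [k' [b' [h1 h2 h3]]]] := approx_advance hb.
  by move=> e; apply: hn; rewrite -e.
by exists (Stage m m' k' c b'), d; split=> //; right.
Qed.

Lemma valid_trunc s t x : valid s t x ->
  trunc rl (level x) (current x) = trunc rl (level x) t.
Proof.
move=> [_ h1 h2 /approx_trunc /(trunc_le (ltnW h1)) <-].
by apply: deep_trunc; exists (remaining x).+1.
Qed.

(** While the level is constant, [remaining] decreases, so the level must grow again and again. *)
Lemma advances_unbounded (x : nat -> stage) :
  (forall j, advances (x j) (x j.+1)) ->
  forall n, exists j, forall i, j <= i -> n <= level (x i).
Proof.
move=> adv.
have mono i j : i <= j -> level (x i) <= level (x j).
  move=> /subnKC <-; elim: (j - i) => [|k IH]; first by rewrite addn0.
  rewrite addnS; apply: leq_trans IH _.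
  by case: (adv (i + k)) => [[-> _]|/ltnW].
have next j : exists i, level (x j) < level (x i).
  move e: (remaining (x j)) => k; elim: k j e => [|k IH] j e.
    by exists j.+1; case: (adv j) => // -[_]; rewrite e.
  case: (adv j) => [[-> ej]|h]; last by exists j.+1.
  by apply: IH; move: ej; rewrite e => -[].
elim=> [|n [j hj]]; first by exists 0.
have [i hi] := next j; exists i => k hk.
exact: leq_trans (leq_ltn_trans (hj _ (leqnn _)) hi) (mono _ _ hk).
Qed.

Definition omega_lt (x y : option nat) : Prop :=
  match x, y with
  | Some a, Some b => a < b
  | Some _, None => True
  | None, _ => False
  end.

Lemma omega_lt_trans x y z : omega_lt x y -> omega_lt y z -> omega_lt x z.
Proof. by case: x y z => [a|] [b|] [c|] //=; apply: ltn_trans. Qed.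

Lemma omega_lt_total x y : omega_lt x y \/ x = y \/ omega_lt y x.
Proof.
case: x y => [a|] [b|] /=; auto.
by case: (ltngtP a b) => [||->]; auto.
Qed.

Lemma omega_lt_wf : well_founded omega_lt.
Proof.
have h a : Acc omega_lt (Some a).
  elim/ltn_ind: a => a IH; constructor=> -[b /IH|[]]; exact.
case=> [a|]; first exact: h.
constructor=> -[a _|[]]; exact: h.
Qed.

Definition omega_wellorder : wellorder :=
  WellOrder omega_lt_trans omega_lt_total omega_lt_wf.

(** A finite reduction is treated on its own; otherwise the stages never end, and they converge to
    [t] because their levels are unbounded. *)
Lemma full0_red_infty s t : full0 zero s t -> red_infty zero s t.
Proof.
move=> hst; case: (classic (reds zero s t)) => [|hn]; first exact: reds_red_infty.
have [|m [k [s' [hm hs' ht]]]] := approx_advance (approx0 hst).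
  by move=> e; apply: hn; rewrite e; apply: rt_refl.
pose x0 := Stage 0 m k s s'.
have v0 : valid s t x0 by split=> //; apply: rt_refl.
(* [f] chooses the next stage and the depth of the step to it; stages that are not valid get a dummy
   value. *)
have /choice [f hf] : forall x, exists p : stage * nat, valid s t x ->
    [/\ valid s t p.1, advances x p.1, level x <= p.2
      & step zero p.2 (current x) (current p.1)].
  move=> x; case: (classic (valid s t x)) => [/(valid_next hn) [y [d h]]|h].
    by exists (y, d).
  by exists (x, 0).
pose x j := iter j (fun y => (f y).1) x0.
have vx j : valid s t (x j) by elim: j => // j /hf [].
have [adv dge st] : [/\ forall j, advances (x j) (x j.+1),
    forall j, level (x j) <= (f (x j)).2 &
    forall j, step zero (f (x j)).2 (current (x j)) (current (x j.+1))].
  by split=> j; case: (hf _ (vx j)).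
exists omega_wellorder, (Some 0), None,
  (fun y => if y is Some j then current (x j) else t),
  (fun y => if y is Some j then (f (x j)).2 else 0).
split=> //; first by case.
apply/strongly_convergingP; split.
  case=> [a|] [b|] [hab hs] _; try by case: hab.
    suff -> : b = a.+1 by apply: st.
    apply/eqP; rewrite eqn_leq [_ < _]hab andbT leqNgt; apply/negP => h.
    exact: (hs (Some a.+1) (ltnSn a)).
  by case: (hs (Some a.+1) (ltnSn a)).
case=> [[|l]|] [hz hs] _.
- by case: hz => -[].
- case: (hs (Some l)); split=> [|[z|] h1 h2 //]; first exact: ltnSn.
  by have := leq_trans (h2 : z < l.+1) h1; rewrite ltnn.
move=> n; have [j hj] := advances_unbounded adv n.
exists (Some j) => // -[i|] //= /ltnW /hj hi _; split.
  exact/(trunc_le hi)/valid_trunc/vx.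
exact: leq_trans hi (dge i).
Qed.

End Approximation.

(** * The criterion for both forms of the Compression property *)

Theorem theorem3p5 (St D : Type) (rl : D -> rule St)
    (zero : derivation rl -> derivation rl -> Prop) :
  (ordinal_compression zero <-> Q zero) /\
  (preserves_conclusions zero -> (compression zero <-> Q zero)).
Proof.
split; first split; first exact: ordinal_compression_Q.
  by move=> /Q_step_absorption; apply: absorption_ordinal_compression.
move=> hp; split=> [c|/Q_step_absorption absorb s t].
  exact/ordinal_compression_Q/absorption_ordinal_compression/compression_absorption.
split=> [/(red_infty_full0 absorb) /compressedE //|/compressedE].
exact: full0_red_infty.
Qed.
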